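(* Let $m, n, k$ be positive integers satisfying $$\min\{m,n\} \geq k > k_0, \qquad k_0 = 108 \log(m + n + 1).$$ Let $\varepsilon \in (\sqrt{k_0 / k}, 1)$ and let $r$ be a positive integer satisfying $k > r \geq k_0 / \varepsilon^2$. Then for every matrix $X \in \mathbb{R}^{m \times n}$ of rank $k$ there exists a matrix $Y \in \mathbb{R}^{m \times n}$ of rank $r$ such that $$\| X - Y \|_{\max} \leq \frac{\varepsilon}{3} \left(\frac{k}{m}\, \mu_{\mathrm{col}} + \frac{k}{n}\, \mu_{\mathrm{row}} + \frac{\gamma_X}{\sqrt{mn}} \right) \| X \|_{2},$$ where $\mu_{\mathrm{col}}$ and $\mu_{\mathrm{row}}$ are the coherences of the column space of $X$ (a subspace of $\mathbb{R}^m$) and of the row space of $X$ (a subspace of $\mathbb{R}^n$), respectively, and $\gamma_X$ is the spikiness of $X$.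
   Context: $\log$ is the natural logarithm. For a real matrix $X \in \mathbb{R}^{m\times n}$, $\|X\|_{\max} = \max_{i,j} |X(i,j)|$ is the maximum norm and $\|X\|_2$ is the spectral norm (largest singular value). The spikiness of a nonzero matrix $X \in \mathbb{R}^{m \times n}$ is $\gamma_X = \sqrt{mn}\, \|X\|_{\max} / \|X\|_2$. For a $k$-dimensional subspace $L \subseteq \mathbb{R}^m$ with orthogonal projection operator $\Pi_L : \mathbb{R}^m \to L$, the coherence of $L$ is $\mu_L = \frac{m}{k} \max_{1 \le i \le m} \|\Pi_L e_i\|^2$, where $e_1,\dots,e_m$ are the canonical basis vectors of $\mathbb{R}^m$ and $\|\cdot\|$ is the Euclidean norm; the same definition is used for subspaces of $\mathbb{R}^n$, with $n$ in place of $m$. *)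

(* Defs.v *)
From mathcomp Require Import all_boot all_order all_algebra.
From mathcomp Require Import all_classical all_reals all_analysis.

Set Implicit Arguments.
Unset Strict Implicit.
Unset Printing Implicit Defensive.

Import Order.TTheory GRing.Theory Num.Theory.

Local Open Scope classical_set_scope.
Local Open Scope ring_scope.

(* Vectors of R^d are row vectors 'rV[R]_d, and a subspace of R^d is the row
   space of a matrix with d columns, as in mxalgebra. The column space of X is
   thus the row space of X^T. The maximum norm is the library's mx_norm. *)

(* X^T *m X has n - m superfluous zero eigenvalues when n > m; the largest
   singular value is not affected. *)
Definition singular_value (R : realType) (m n : nat) (X : 'M[R]_(m, n)) :
    set R :=
  [set s | 0 <= s /\ eigenvalue (X^T *m X) (s ^+ 2)].

(* For n > 0 the set is finite and nonempty, so that sup is its maximum. *)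
Definition spectral_norm (R : realType) (m n : nat) (X : 'M[R]_(m, n)) : R :=
  sup (singular_value X).

Definition spikiness (R : realType) (m n : nat) (X : 'M[R]_(m, n)) : R :=
  Num.sqrt (m%:R * n%:R) * mx_norm X / spectral_norm X.

Definition euclidean_norm (R : realType) (d : nat) (v : 'rV[R]_d) : R :=
  Num.sqrt (\sum_(i < d) v 0 i ^+ 2).

(* The rows of kermx L^T span the vectors v such that v *m L^T = 0, i.e. those
   orthogonal to every row of L. *)
Definition orthogonal_complement (R : realType) (p d : nat)
    (L : 'M[R]_(p, d)) : 'M[R]_d :=
  kermx L^T.

(* Acts on row vectors by right multiplication. *)
Definition orthogonal_projection (R : realType) (p d : nat)
    (L : 'M[R]_(p, d)) : 'M[R]_d :=
  proj_mx <<L>>%MS (orthogonal_complement L).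

Definition coherence (R : realType) (p d : nat) (L : 'M[R]_(p, d)) : R :=
  d%:R / (\rank L)%:R *
  \big[Num.max/0]_(i < d)
    euclidean_norm (delta_mx 0 i *m orthogonal_projection L) ^+ 2.

Definition col_coherence (R : realType) (m n : nat) (X : 'M[R]_(m, n)) : R :=
  coherence X^T.

Definition row_coherence (R : realType) (m n : nat) (X : 'M[R]_(m, n)) : R :=
  coherence X.

(* Main.v *)
Require Import Defs.
From mathcomp Require Import all_boot all_order all_algebra.
From mathcomp Require Import all_classical all_reals all_analysis.
From mathcomp Require Import ring lra.

Set Implicit Arguments.
Unset Strict Implicit.
Unset Printing Implicit Defensive.

Import Order.TTheory GRing.Theory Num.Theory.
Import numFieldNormedType.Exports.

Local Open Scope ring_scope.

(** The idea is to write [X] as a matrix of inner products and to embed the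
    vectors in low dimension.  If [P] is the orthogonal projection onto the
    column space of [X], then [X = P X], so that the entry [X i j] is the inner
    product of [a_i = e_i P] and [b_j], the [j]-th column of [X].  The first vector satisfies [|a_i|^2 <= k/m mu_col] by the
    definition of coherence; and as [b_j] is also the image under [X] of the
    projection of [e_j] to the row space, [|b_j|^2 <= |X|_2^2 k/n mu_row].
    The last step uses that [X] stretches vectors at most by its spectral norm
    ([spectral_norm_bound]).

    By the Johnson-Lindenstrauss lemma there is a linear map [G] into [R^r]
    that almost preserves all the inner products [<a_i, b_j>].  The matrix of
    the [<a_i G, b_j G>] factors through [R^r], hence has rank at most [r], and
    it is entrywise close to [X].  This is [low_rank_approximation]; it rests
    on [johnson_lindenstrauss_dot], in which the inner products are recovered
    from the squared norms of [|X|_2 a_i + b_j] and [|X|_2 a_i - b_j].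

    The map [G] has entries [+1] or [-1] divided by [sqrt r], so that
    probabilities are counts of sign patterns.  The tail bound comes from the
    estimate [E exp(lam Z^2) <= exp(lam q + 2 (lam q)^2)], where [|lam| q <= 1/4], for a
    sum [Z] of independent signs times the coordinates of a vector of squared norm
    [q] ([rademacher_mgf]), proved by averaging over one sign at a time with
    [cosh y <= exp (y^2 / 2)].

    The error so obtained has the factor [eps / 4] in place of [eps / 3].  This
    leaves room to perturb the approximation, whose rank may be less than [r],
    into one of rank exactly [r] ([perturb_rank]). *)

(** * Inner products *)

Definition dot (R : realType) (d : nat) (u v : 'rV[R]_d) : R := (u *m v^T) 0 0.

Section Dot.
Variables (R : realType) (d : nat).
Implicit Types u v w : 'rV[R]_d.

Lemma dotE u v : dot u v = \sum_i u 0 i * v 0 i.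
Proof. by rewrite /dot mxE; apply: eq_bigr => i _; rewrite mxE. Qed.

Lemma dotC u v : dot u v = dot v u.
Proof. by rewrite !dotE; apply: eq_bigr => i _; rewrite mulrC. Qed.

Lemma dotDl u v w : dot (u + v) w = dot u w + dot v w.
Proof. by rewrite /dot mulmxDl mxE. Qed.

Lemma dotZl c u v : dot (c *: u) v = c * dot u v.
Proof. by rewrite /dot -scalemxAl mxE. Qed.

Lemma dotDr u v w : dot w (u + v) = dot w u + dot w v.
Proof. by rewrite !(dotC w) dotDl. Qed.

Lemma dotZr c u v : dot u (c *: v) = c * dot u v.
Proof. by rewrite dotC dotZl dotC. Qed.

Lemma dotvv u : dot u u = \sum_i u 0 i ^+ 2.
Proof. by rewrite dotE; apply: eq_bigr => i _; rewrite expr2. Qed.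

Lemma dot_ge0 u : 0 <= dot u u.
Proof. by rewrite dotvv; apply: sumr_ge0 => i _; exact: sqr_ge0. Qed.

Lemma dot_eq0 u : (dot u u == 0) = (u == 0).
Proof.
apply/eqP/eqP => [|->]; last by rewrite /dot mul0mx mxE.
rewrite dotvv => /eqP; rewrite psumr_eq0 => [/allP u0|i _]; last exact: sqr_ge0.
apply/rowP => i; rewrite mxE; apply/eqP.
by move/(_ i): u0; rewrite mem_index_enum /= sqrf_eq0 => /(_ isT).
Qed.

Lemma dot_gt0 u : u != 0 -> 0 < dot u u.
Proof. by rewrite -dot_eq0 lt0r dot_ge0 andbT. Qed.

Lemma euclidean_norm_sqr u : euclidean_norm u ^+ 2 = dot u u.
Proof. by rewrite /euclidean_norm sqr_sqrtr -dotvv// dot_ge0. Qed.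

Lemma dot_mulmx e (A : 'M[R]_(e, d)) (v : 'rV[R]_e) u :
  dot (v *m A) u = dot v (u *m A^T).
Proof. by rewrite /dot trmx_mul trmxK mulmxA. Qed.

End Dot.

(** * Orthogonal projections and coherence *)

Section Projection.
Variables (R : realType) (p d : nat) (L : 'M[R]_(p, d)).

Lemma orthogonal_complement_cap : (<<L>> :&: orthogonal_complement L = 0)%MS.
Proof.
apply/eqP; rewrite -submx0; apply/rV_subP => v; rewrite sub_capmx genmxE.
case/andP=> /submxP[D vE] /sub_kermxP vL0; rewrite submx0 -dot_eq0 {1}vE.
by rewrite dot_mulmx vL0 /dot trmx0 mulmx0 mxE.
Qed.

(** Over the reals a subspace and its orthogonal complement meet trivially, so
    that counting dimensions makes them span. *)
Lemma orthogonal_complement_adds :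
  (1%:M <= <<L>> + orthogonal_complement L)%MS.
Proof.
rewrite sub1mx /row_full -[X in X == _]addn0.
rewrite -(mxrank0 R d d) -orthogonal_complement_cap mxrank_sum_cap.
by rewrite genmxE mxrank_ker mxrank_tr subnKC// rank_leq_col.
Qed.

Lemma mul_orthogonal_projection : L *m orthogonal_projection L = L.
Proof.
by rewrite proj_mx_id ?orthogonal_complement_cap// genmxE.
Qed.

(** The rows of [1 - P] are orthogonal to the rows of [L], hence to those of
    [P], that is [P^T = P P^T]; the right-hand side is symmetric. *)
Lemma orthogonal_projection_sym :
  (orthogonal_projection L)^T = orthogonal_projection L.
Proof.
set P := orthogonal_projection L.
have /submxP[D PE] : (P <= L)%MS.
  by rewrite -(genmxE L) -[P]mul1mx proj_mx_sub.
have PPT : P^T = P *m P^T.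
  apply/eqP; rewrite -subr_eq0 -{1}[P^T]mul1mx -mulmxBl {2}PE trmx_mul mulmxA.
  have /sub_kermxP : (1%:M - P <= orthogonal_complement L)%MS.
    by rewrite -{1}[P]mul1mx proj_mx_compl_sub ?orthogonal_complement_adds.
  by move=> ->; rewrite mul0mx.
by have := congr1 trmx PPT; rewrite trmxK trmx_mul trmxK -PPT => <-.
Qed.

Lemma coherence_bound (i : 'I_d) : (0 < \rank L)%N ->
  dot (delta_mx 0 i *m orthogonal_projection L)
    (delta_mx 0 i *m orthogonal_projection L) <=
  (\rank L)%:R / d%:R * coherence L.
Proof.
move=> L0; have d0 : (0 < d)%N by apply: leq_trans L0 (rank_leq_col _).
have rank_neq0 : (\rank L)%:R != 0 :> R by rewrite pnatr_eq0 -lt0n.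
have d_neq0 : d%:R != 0 :> R by rewrite pnatr_eq0 -lt0n.
rewrite /coherence -euclidean_norm_sqr.
set M := \big[_/_]_(_ < _) _.
have -> : (\rank L)%:R / d%:R * (d%:R / (\rank L)%:R * M) = M.
  by field; rewrite rank_neq0.
exact: (le_bigmax _ (fun i => euclidean_norm (delta_mx 0 i *m _) ^+ 2)).
Qed.

(** If the coherence vanished, every [e_i] would project to [0], although the
    projection fixes the rows of [L]. *)
Lemma coherence_gt0 : (0 < \rank L)%N -> 0 < (\rank L)%:R / d%:R * coherence L.
Proof.
move=> L0; rewrite ltNge; apply/negP => coh_le0.
suff LP0 : L = 0 by rewrite LP0 mxrank0 in L0.
rewrite -mul_orthogonal_projection; apply/eqP.
suff -> : orthogonal_projection L = 0 by rewrite mulmx0.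
apply/row_matrixP => i; rewrite row0 rowE; apply/eqP.
by rewrite -dot_eq0 eq_le dot_ge0 andbT (le_trans (coherence_bound i L0)).
Qed.

End Projection.

(** * The spectral norm as a Rayleigh quotient *)

Lemma continuous_dot_mulmx (R : realType) (d e : nat) (A : 'M[R]_(d, e)) :
  continuous (fun v : 'rV[R]_d => dot (v *m A) (v *m A)).
Proof.
have -> : (fun v : 'rV[R]_d => dot (v *m A) (v *m A)) =
    fun v => \sum_i (\sum_j v 0 j * A j i) * (\sum_j v 0 j * A j i).
  by apply/funext => v; rewrite dotE; apply: eq_bigr => i _; rewrite mxE.
have cont_coord i : continuous (fun v : 'rV[R]_d => \sum_j v 0 j * A j i).
  apply: (@continuous_big _ _ +%R); first exact: add_continuous.
  move=> j _ v; apply: continuousM; last exact: cst_continuous.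
  exact: coord_continuous.
apply: (@continuous_big _ _ +%R); first exact: add_continuous.
by move=> i _ v; apply: continuousM; exact: cont_coord.
Qed.

Lemma compact_sphere (R : realType) (d : nat) :
  compact [set v : 'rV[R]_d | dot v v = 1].
Proof.
apply: bounded_closed_compact.
  exists 1; split => // M M1 v /= v1; apply: le_trans (ltW M1).
  rewrite /Num.norm /= mx_normrE; apply: bigmax_le => // -[i j] _ /=.
  rewrite ord1 -(expr_le1 (n := 2))// real_normK ?num_real// -v1 dotvv.
  by rewrite (bigD1 j)//= lerDl sumr_ge0// => l _; exact: sqr_ge0.
have /continuous_closedP/(_ [set 1]%classic) := @continuous_dot_mulmx R d d 1%:M.
under [X in (X @^-1` _)%classic]funext do rewrite mulmx1.
by apply; exact: closed_eq.
Qed.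

(** A maximizer [v0] of [|v A|^2] on the unit sphere exists by compactness.
    With [lam] the maximum, the quadratic form [lam |v|^2 - |v A|^2] is
    nonnegative and vanishes at [v0], so that its gradient vanishes there,
    which is the eigenvalue equation. *)
Lemma max_rayleigh (R : realType) (d e : nat) (A : 'M[R]_(d, e)) : (0 < d)%N ->
  exists lam (v0 : 'rV[R]_d), [/\ v0 != 0, v0 *m (A *m A^T) = lam *: v0, 0 <= lam &
    forall v, dot (v *m A) (v *m A) <= lam * dot v v].
Proof.
move=> d_gt0; pose f (v : 'rV[R]_d) := dot (v *m A) (v *m A).
have S0 : ([set v : 'rV[R]_d | dot v v = 1] !=set0)%classic.
  exists (delta_mx 0 (Ordinal d_gt0)) => /=.
  rewrite dotvv (bigD1 (Ordinal d_gt0))//= mxE !eqxx expr1n big1 ?addr0// => i.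
  by rewrite mxE /= => /negbTE->; rewrite expr0n.
have [|v0] := compact_EVT_max S0 (@compact_sphere R d) (f := f).
  by apply: continuous_subspaceT; exact: continuous_dot_mulmx.
rewrite inE /= => v01 v0max.
have maxf v : f v <= f v0 * dot v v.
  have [->|v_neq0] := eqVneq v 0; first by rewrite /f mul0mx /dot !mul0mx mxE mulr0.
  have v_gt0 := dot_gt0 v_neq0; pose c := (Num.sqrt (dot v v))^-1.
  have cc : c * c = (dot v v)^-1 by rewrite -expr2 exprVn sqr_sqrtr ?ltW.
  have := v0max (c *: v); rewrite inE /= /f -scalemxAl !(dotZl, dotZr) !mulrA cc.
  by rewrite mulVf ?gt_eqF// mulrC ler_pdivrMr//; apply.
exists (f v0), v0; split; [| |exact: dot_ge0|exact: maxf].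
  by rewrite -dot_eq0 v01 oner_eq0.
have [w wE] : exists w, w = f v0 *: v0 - v0 *m (A *m A^T) by eexists.
apply/esym/eqP; rewrite -subr_eq0 -wE -dot_eq0; apply/negPn/negP => w0.
have D_gt0 : 0 < dot w w by rewrite lt0r w0 dot_ge0.
pose q := f v0 * dot w w - f w.
have q_ge0 : 0 <= q by rewrite subr_ge0 maxf.
(* The values of the form at [v0 + t w], where [2 w] is its gradient at [v0]. *)
have quad t : 0 <= 2 * t * dot w w + t ^+ 2 * q.
  have := maxf (v0 + t *: w); rewrite -subr_ge0; congr (_ <= _).
  rewrite /q /f mulmxDl -scalemxAl !(dotDl, dotDr, dotZl, dotZr) v01.
  rewrite (dotC w v0) (dotC (w *m A) (v0 *m A)).
  have -> : dot (v0 *m A) (w *m A) = f v0 * dot v0 w - dot w w.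
    rewrite (dotC (v0 *m A)) dot_mulmx -mulmxA dotC -[v0 *m _](subKr (f v0 *: v0)).
    by rewrite -wE dotDl dotZl -scaleN1r dotZl mulN1r.
  rewrite /f; ring.
have qD_gt0 : 0 < q + dot w w by rewrite ltr_wpDl.
(* For small negative [t] the linear term dominates; this [t] is small enough. *)
have := quad (- (dot w w / (q + dot w w))); apply/negP; rewrite -ltNge.
set D := dot w w in D_gt0 qD_gt0 *.
have -> : 2 * - (D / (q + D)) * D + (- (D / (q + D))) ^+ 2 * q =
    - (D ^+ 2 * (q + 2 * D) / (q + D) ^+ 2) by field; rewrite gt_eqF.
rewrite oppr_lt0 divr_gt0 ?exprn_gt0// mulr_gt0 ?exprn_gt0//.
by rewrite ltr_wpDl// mulr_gt0.
Qed.

(** The maximum of the Rayleigh quotient is the square of a singular value, and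
    it bounds the square of any other one; so the supremum of the singular
    values is its square root. *)
Lemma spectral_norm_bound (R : realType) (m n : nat) (X : 'M[R]_(m, n)) :
  (0 < n)%N ->
  0 <= spectral_norm X /\
  forall v : 'rV[R]_n,
    dot (v *m X^T) (v *m X^T) <= spectral_norm X ^+ 2 * dot v v.
Proof.
move=> n_gt0; have [lam [v0 [v0_neq0 v0E lam_ge0 maxX]]] := max_rayleigh X^T n_gt0.
rewrite trmxK in v0E.
suff -> : spectral_norm X = Num.sqrt lam by rewrite sqrtr_ge0 sqr_sqrtr.
have lam_in : singular_value X (Num.sqrt lam).
  by split; [exact: sqrtr_ge0 | apply/eigenvalueP; exists v0; rewrite ?sqr_sqrtr].
have lam_ub : ubound (singular_value X) (Num.sqrt lam).
  move=> s [s_ge0 /eigenvalueP[v vE v_neq0]].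
  rewrite -[s]ger0_norm// -sqrtr_sqr ler_sqrt//.
  rewrite -(ler_pM2r (dot_gt0 v_neq0)) (le_trans _ (maxX v))//.
  by rewrite dot_mulmx trmxK -mulmxA vE dotZr.
apply/eqP; rewrite eq_le; apply/andP; split.
  by apply: ge_sup => //; exists (Num.sqrt lam).
by apply: ub_le_sup => //; exists (Num.sqrt lam).
Qed.

Lemma spectral_norm_gt0 (R : realType) (m n : nat) (X : 'M[R]_(m, n)) :
  (0 < \rank X)%N -> 0 < spectral_norm X.
Proof.
move=> X0; have n_gt0 : (0 < n)%N := leq_trans X0 (rank_leq_col _).
have [sigma_ge0 normX] := spectral_norm_bound X n_gt0.
rewrite lt0r sigma_ge0 andbT; apply/eqP => sigma0.
suff XT0 : X^T = 0 by move: X0; rewrite -mxrank_tr XT0 mxrank0.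
apply/row_matrixP => j; rewrite row0 rowE; apply/eqP.
rewrite -dot_eq0 eq_le dot_ge0 andbT (le_trans (normX _))//.
by rewrite sigma0 expr0n mul0r.
Qed.

(** * Exponential moments of sums of random signs *)

Lemma fact_double_ge (n : nat) : (2 ^ n * n`! <= (n.*2)`!)%N.
Proof.
elim: n => // n IH; rewrite expnS factS mulnACA mul2n doubleS 2!factS.
by rewrite leq_mul// (leq_trans IH)// leq_pmull.
Qed.

(** The power series are compared termwise: [y^(2n) / (2n)!] is at most
    [(y^2/2)^n / n!], and the odd powers cancel. *)
Lemma expR_cosh_le (R : realType) (y : R) :
  expR y + expR (- y) <= 2 * expR (y ^+ 2 / 2).
Proof.
have cvgE (x : R) : (series (exp_coeff x) n @[n --> \oo] --> expR x)%classic.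
  exact: is_cvg_series_exp_coeff.
have cvgE2 (x : R) :
    (series (exp_coeff x) (2 * n)%N @[n --> \oo] --> expR x)%classic.
  have cvg2 := cvg_comp (muln 2) (series (exp_coeff x)) (cvg_mulnl 2 isT) (cvgE x).
  exact: cvg2.
have lhs : ((series (exp_coeff y) (2 * n)%N + series (exp_coeff (- y)) (2 * n)%N)
     @[n --> \oo] --> expR y + expR (- y))%classic by apply: cvgD; exact: cvgE2.
have rhs : ((2 * series (exp_coeff (y ^+ 2 / 2)) n)
     @[n --> \oo] --> 2 * expR (y ^+ 2 / 2))%classic.
  by apply: cvgM; [exact: cvg_cst | exact: cvgE].
apply: ler_cvg_to lhs rhs _.
apply: nearW => n; elim: n => [|n IH].
  by rewrite /= muln0 /series /= !big_geq// addr0 mulr0.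
rewrite mulnS add2n !seriesSr.
have even : exp_coeff (- y) (2 * n)%N = exp_coeff y (2 * n)%N.
  by rewrite /exp_coeff /= !exprM sqrrN.
have odd : exp_coeff (- y) (2 * n)%N.+1 = - exp_coeff y (2 * n)%N.+1.
  by rewrite /exp_coeff /= !exprS !exprM sqrrN !mulNr.
have term : exp_coeff y (2 * n)%N <= exp_coeff (y ^+ 2 / 2) n.
  rewrite /exp_coeff /= expr_div_n exprM -mulrA ler_wpM2l//; first exact/exprn_ge0/sqr_ge0.
  rewrite -invfM lef_pV2 ?posrE ?mulr_gt0 ?exprn_gt0 ?ltr0n ?fact_gt0//.
  by rewrite -natrX -natrM ler_nat mul2n fact_double_ge.
rewrite even odd; lra.
Qed.

(** Averaging over a single sign is done by the involution that flips it, which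
    keeps the sums over one type of sign patterns. *)
Definition flip (I : finType) (i : I) (s : {ffun I -> bool}) : {ffun I -> bool} :=
  [ffun j => s j (+) (j == i)].

Lemma flipK (I : finType) (i : I) : involutive (flip i).
Proof. by move=> s; apply/ffunP => j; rewrite !ffunE addbK. Qed.

(** The indices range over a list so that the moment bound can be proved by
    induction on the list. *)
Definition signed_sum (R : realType) (I : finType) (a : I -> R) (l : seq I)
    (s : {ffun I -> bool}) : R :=
  \sum_(i <- l) (-1) ^+ s i * a i.

Lemma signed_sum_flip (R : realType) (I : finType) (a : I -> R) (l : seq I) i s :
  i \notin l -> signed_sum a l (flip i s) = signed_sum a l s.
Proof.
move=> il; apply: eq_big_seq => j jl; rewrite ffunE.
by case: eqVneq jl il => [->->|]; rewrite ?addbF.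
Qed.

(** One step of the average over signs: the mixed term [2 lam a u] of the two
    squares is controlled by the bound on the hyperbolic cosine, and besides
    the factor [exp (lam a^2)] its effect is to increase the coefficient of
    [u^2]. *)
Lemma expR_sqr_signs_le (R : realType) (lam u a : R) :
  expR (lam * (a + u) ^+ 2) + expR (lam * (- a + u) ^+ 2) <=
  2 * (expR (lam * a ^+ 2) * expR (lam * (1 + 2 * (lam * a ^+ 2)) * u ^+ 2)).
Proof.
have -> : lam * (a + u) ^+ 2 = lam * a ^+ 2 + lam * u ^+ 2 + 2 * lam * a * u.
  by ring.
have -> : lam * (- a + u) ^+ 2 =
    lam * a ^+ 2 + lam * u ^+ 2 + - (2 * lam * a * u) by ring.
have -> : lam * (1 + 2 * (lam * a ^+ 2)) * u ^+ 2 =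
    lam * u ^+ 2 + (2 * lam * a * u) ^+ 2 / 2 by field.
rewrite !expRD -mulrDr.
set e1 := expR (lam * a ^+ 2); set e2 := expR (lam * u ^+ 2).
set X := expR (_ / 2); have -> : 2 * (e1 * (e2 * X)) = e1 * e2 * (2 * X) by ring.
by rewrite ler_wpM2l ?mulr_ge0 ?expR_ge0// expR_cosh_le.
Qed.

(** Each coordinate [a i] that is averaged out replaces [lam] by
    [lam (1 + 2 lam (a i)^2)].  With [y = lam (a i)^2], and [w] the value of
    [lam q] for the remaining coordinates, the new value [w (1 + 2 y)]
    stays within the range [1/4] of the hypothesis, and the exponent
    [t + 2 t^2] at [t = y + w] absorbs the step. *)
Lemma rademacher_mgf (R : realType) (I : finType) (a : I -> R) (l : seq I) (lam : R) :
  uniq l -> `|lam| * \sum_(i <- l) a i ^+ 2 <= 1 / 4 ->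
  \sum_s expR (lam * signed_sum a l s ^+ 2) <=
  #|{ffun I -> bool}|%:R *
  expR (lam * (\sum_(i <- l) a i ^+ 2) + 2 * (lam * (\sum_(i <- l) a i ^+ 2)) ^+ 2).
Proof.
elim: l lam => [|i l IH] lam /=.
  move=> _ _; rewrite big_nil mulr0 expr0n/= mulr0 addr0.
  under eq_bigr do rewrite /signed_sum big_nil expr0n/= mulr0.
  by rewrite expR0 sumr_const mulr1.
case/andP=> il ul; rewrite big_cons; set q := \sum_(j <- l) _ => hq.
have q_ge0 : 0 <= q by apply: sumr_ge0 => j _; exact: sqr_ge0.
have a_ge0 := sqr_ge0 (a i).
set lam' := lam * (1 + 2 * (lam * a i ^+ 2)).
have step : \sum_s expR (lam * signed_sum a (i :: l) s ^+ 2) <=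
    \sum_s expR (lam * a i ^+ 2) * expR (lam' * signed_sum a l s ^+ 2).
  rewrite -(ler_pM2l (ltr0Sn R 1)) mulr_natl mulr2n.
  rewrite [X in X + _](reindex_inj (inv_inj (flipK i))) /= -big_split /=.
  rewrite mulr_sumr; apply: ler_sum => s _.
  rewrite /signed_sum !big_cons ffunE eqxx addbT -!/(signed_sum _ _ _).
  rewrite signed_sum_flip// signrN mulNr.
  case: (s i); last by rewrite addrC mul1r expR_sqr_signs_le.
  by rewrite mulN1r opprK expR_sqr_signs_le.
apply: le_trans step _; rewrite -mulr_sumr.
have hq' : `|lam'| * q <= 1 / 4.
  rewrite normrM -mulrA (le_trans _ hq)//.
  have ya_ge0 : 0 <= `|lam| * a i ^+ 2 by rewrite mulr_ge0.
  have yq_ge0 : 0 <= `|lam| * q by rewrite mulr_ge0.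
  have : `|1 + 2 * (lam * a i ^+ 2)| <= 1 + 2 * (`|lam| * a i ^+ 2).
    by rewrite (le_trans (ler_normD _ _))// normr1 2!normrM (ger0_norm a_ge0) ger0_norm.
  move: ya_ge0 yq_ge0 hq; rewrite mulrDr; nra.
have h := IH lam' ul hq'.
rewrite (le_trans (ler_wpM2l (expR_ge0 _) h))// mulrCA ler_wpM2l// -expRD ler_expR.
rewrite -/q /lam' [_ * _ * q]mulrAC [lam * (_ + q)]mulrDr.
have : 0 <= (lam * a i ^+ 2) * (lam * q).
  by rewrite mulrACA -expr2 mulr_ge0 ?sqr_ge0// mulr_ge0.
have : `|lam * q| <= 1 / 4.
  rewrite normrM (ger0_norm q_ge0) (le_trans _ hq)// ler_wpM2l// lerDr//.
move: (lam * q) (lam * a i ^+ 2) => w y; rewrite ler_norml => /andP[wl wr] wy.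
have wy1 : 0 <= y * w * (1 - 4 * w) by rewrite mulr_ge0//; lra.
have wy2 : 0 <= y ^+ 2 * (1 - 4 * w ^+ 2).
  by rewrite mulr_ge0 ?sqr_ge0//; nra.
rewrite -subr_ge0.
have -> : y + w + 2 * (y + w) ^+ 2 -
    (y + (w * (1 + 2 * y) + 2 * (w * (1 + 2 * y)) ^+ 2)) =
  2 * (y * w * (1 - 4 * w)) + 2 * (y ^+ 2 * (1 - 4 * w ^+ 2)) by ring.
by rewrite addr_ge0// mulr_ge0.
Qed.

(** The rows of a sign matrix are independent: the sum over all matrices of a
    product over the rows is a power of the sum over a single row. *)
Lemma rademacher_chaos_mgf (R : realType) (I : finType) (r : nat) (a : I -> R)
    (lam : R) :
  `|lam| * \sum_i a i ^+ 2 <= 1 / 4 ->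
  \sum_(S : {ffun 'I_r -> {ffun I -> bool}})
    expR (lam * \sum_t signed_sum a (index_enum I) (S t) ^+ 2) <=
  #|{ffun 'I_r -> {ffun I -> bool}}|%:R *
  expR (r%:R * (lam * (\sum_i a i ^+ 2) + 2 * (lam * (\sum_i a i ^+ 2)) ^+ 2)).
Proof.
move=> /(rademacher_mgf (index_enum_uniq I)) mgf.
under eq_bigr do rewrite mulr_sumr expR_sum.
rewrite -(bigA_distr_bigA (fun _ s =>
  expR (lam * signed_sum a (index_enum I) s ^+ 2))) /=.
rewrite prodr_const card_ord card_ffun card_ord natrX expRM_natl -exprMn.
by rewrite lerXn2r// nnegrE ?mulr_ge0 ?expR_ge0// sumr_ge0// => s _; exact: expR_ge0.
Qed.

(** * Random sign embeddings *)

(** The two tails are bounded by exponential penalties with the Chernoff parameter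
    [lam = +- delta / (4 |x_j|^2)], which makes the mean of a penalty at most
    [exp (- r delta^2 / 8)].  There are two penalties for each nonzero vector, so the
    mean of their total is less than [1], and some sign matrix attains a value
    less than [1]. *)
Lemma johnson_lindenstrauss (R : realType) (J : finType) (d r : nat)
    (x : J -> 'rV[R]_d) (delta : R) :
  (0 < r)%N -> 0 < delta <= 1 ->
  2 * #|J|%:R * expR (- (r%:R * delta ^+ 2 / 8)) < 1 ->
  exists G : 'M[R]_(d, r), forall j,
    `|dot (x j *m G) (x j *m G) - dot (x j) (x j)| <= delta * dot (x j) (x j).
Proof.
move=> r_gt0 /andP[delta_gt0 delta_le1] small.
have r_gt0R : 0 < r%:R :> R by rewrite ltr0n.
pose signs := {ffun 'I_r -> {ffun 'I_d -> bool}}.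
pose q j := dot (x j) (x j).
(* [r] times the squared norm of the image of [x j]. *)
pose energy (S : signs) j : R :=
  \sum_t signed_sum (x j 0) (index_enum 'I_d) (S t) ^+ 2.
pose G (S : signs) : 'M[R]_(d, r) :=
  \matrix_(i, t) ((-1) ^+ S t i / Num.sqrt r%:R).
have energyE S j : dot (x j *m G S) (x j *m G S) = energy S j / r%:R.
  rewrite dotvv /energy mulr_suml; apply: eq_bigr => t _.
  rewrite -[in RHS](sqr_sqrtr (ltW r_gt0R)) -expr_div_n mxE; congr (_ ^+ 2).
  by rewrite /signed_sum mulr_suml; apply: eq_bigr => i _; rewrite mxE mulrCA mulrA.
(* [penalty S j b] is [1] exactly when the relative error at a nonzero
   [x j], signed by [b], equals [delta]. *)
pose penalty (S : signs) (j : J) (b : bool) : R :=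
  let lam := (-1) ^+ b * (delta / 4) / q j in
  expR (lam * energy S j) * expR (- (lam * (r%:R * q j) + r%:R * delta ^+ 2 / 4)).
have mean_penalty j b : q j != 0 ->
    \sum_S penalty S j b <= #|signs|%:R * expR (- (r%:R * delta ^+ 2 / 8)).
  move=> q_neq0; rewrite /penalty /= -mulr_suml; set lam := _ / q j.
  have lamq : lam * q j = (-1) ^+ b * (delta / 4) by rewrite /lam divfK.
  have lamq2 : (lam * q j) ^+ 2 = delta ^+ 2 / 16.
    by rewrite lamq exprMn -exprM mulnC exprM sqrrN !expr1n mul1r; field.
  have qE : \sum_i x j 0 i ^+ 2 = q j by rewrite /q dotvv.
  have /(rademacher_chaos_mgf r) : `|lam| * \sum_i x j 0 i ^+ 2 <= 1 / 4.
    rewrite qE -[q j]ger0_norm ?dot_ge0// -normrM lamq normrM normrX normrN1.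
    by rewrite expr1n mul1r ger0_norm; lra.
  rewrite qE => /(ler_wpM2r (expR_ge0 _)) mgf; apply: (le_trans (mgf _)).
  rewrite -[leLHS]mulrA; apply: (ler_wpM2l (ler0n _ _)).
  by rewrite -expRD ler_expR lamq2 le_eqVlt; apply/orP; left; apply/eqP; field.
have [S goodS] : exists S, forall j b, q j != 0 -> penalty S j b < 1.
  have penalty_ge0 S j b : 0 <= penalty S j b by rewrite mulr_ge0 ?expR_ge0.
  pose total S := \sum_(j | q j != 0) \sum_(b : bool) penalty S j b.
  suff [S totalS] : exists S, total S < 1.
    exists S => j b qj; apply: le_lt_trans totalS.
    rewrite /total (bigD1 j)//= (bigD1 b)//= -addrA lerDl.
    by rewrite addr_ge0 ?sumr_ge0// => i _; rewrite sumr_ge0.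
  have mean_lt : \sum_S total S < #|signs|%:R.
    rewrite exchange_big /=.
    apply: (@le_lt_trans _ _ (\sum_(j : J) \sum_(b : bool)
      #|signs|%:R * expR (- (r%:R * delta ^+ 2 / 8)))).
      rewrite [leRHS](bigID (fun j => q j != 0)) /= ler_wpDr//.
        by rewrite !sumr_ge0// => j _; rewrite sumr_ge0// => b _; rewrite mulr_ge0 ?expR_ge0.
      by apply: ler_sum => j qj; rewrite exchange_big; apply: ler_sum => b _; exact: mean_penalty.
    rewrite !sumr_const card_bool -mulrnA -mulr_natl.
    have signs_gt0 : 0 < #|signs|%:R :> R.
      by rewrite ltr0n; apply/card_gt0P; exists [ffun=> [ffun=> false]].
    have := small; rewrite -(ltr_pM2l signs_gt0) mulr1; congr (_ < _).
    by rewrite -[RHS]mulr_natr natrM; ring.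
  apply: contrapT => /forallNP total_ge1; move: mean_lt.
  apply/negP; rewrite -leNgt.
  rewrite -sum1_card natr_sum; apply: ler_sum => S _; rewrite leNgt.
  by apply/negP; exact: total_ge1.
exists (G S) => j; rewrite energyE -/(q j).
have [q0|q_neq0] := eqVneq (q j) 0.
  have x0 : x j = 0 by apply/eqP; rewrite -dot_eq0 -/(q j) q0.
  by rewrite -energyE x0 mul0mx -/(q j) q0 mulr0 subr0 /dot mul0mx mxE normr0.
have q_gt0 : 0 < q j by rewrite lt0r q_neq0 dot_ge0.
have bound (b : bool) : (-1) ^+ b * (energy S j / r%:R - q j) <= delta * q j.
  have := goodS j b q_neq0; rewrite /penalty /= -expRD -[ltRHS]expR0 ltr_expR => /ltW.
  set e := energy S j; set c : R := (-1) ^+ b.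
  have -> : c * (delta / 4) / q j * e + - (c * (delta / 4) / q j * (r%:R * q j) +
      r%:R * delta ^+ 2 / 4) =
      (c * (e / r%:R - q j) - delta * q j) * (r%:R * delta / (4 * q j)).
    by field; rewrite q_neq0 gt_eqF.
  by rewrite pmulr_lle0 ?subr_le0// divr_gt0 ?mulr_gt0.
rewrite ler_norml; have := bound true; have := bound false.
rewrite expr0 expr1 mul1r mulN1r => -> b1; rewrite andbT lerNl//.
Qed.

(** * Low-rank approximation *)

(** In the bases of the Gaussian elimination of [Y] the matrix is diagonal with
    [\rank Y] ones; placing a small constant [c] in the diagonal positions from
    [\rank Y] to [r - 1] gives the rank [r]. *)
Lemma perturb_rank (R : realType) (m n r : nat) (Y : 'M[R]_(m, n)) (eta : R) :
  (\rank Y <= r)%N -> (r <= minn m n)%N -> 0 < eta ->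
  exists Y' : 'M[R]_(m, n), \rank Y' = r /\ mx_norm (Y' - Y) <= eta.
Proof.
move=> sr; rewrite leq_min => /andP[rm rn] eta_gt0; set s := \rank Y in sr.
pose E := col_ebase Y *m (pid_mx r - pid_mx s) *m row_ebase Y.
pose c := eta / (1 + mx_norm E).
have E_ge0 : 0 <= mx_norm E := normr_ge0 (E : 'M[R]_(m, n)).
have c_gt0 : 0 < c by rewrite divr_gt0// ltr_pwDl.
exists (Y + c *: E); split; last first.
  rewrite addrC addKr -[mx_norm _]/(`|c *: E|) normrZ gtr0_norm//.
  rewrite -mulrA ger_pMr// mulrC ler_pdivrMr ?ltr_pwDl// mul1r.
  by rewrite ler_wpDl.
pose D : 'rV[R]_m := \row_i (if (i < s)%N then 1 else c).
have -> : Y + c *: E = col_ebase Y *m (diag_mx D *m pid_mx r) *m row_ebase Y.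
  rewrite -{1}(mulmx_ebase Y) -/s /E scalemxAl scalemxAr -mulmxDl -mulmxDr.
  congr (_ *m _ *m _); apply/matrixP => i j.
  rewrite mul_diag_mx !mxE; case: ltnP => [is_|_].
    by rewrite (leq_trans is_ sr) !andbT subrr mulr0 addr0 mul1r.
  by rewrite !andbF add0r subr0.
rewrite mxrankMfree ?row_free_unit ?row_ebase_unit//.
rewrite (eqmxMfull _ _) ?row_full_unit ?col_ebase_unit//.
rewrite (eqmxMfull _ _) ?rank_pid_mx// row_full_unit unitmxE det_diag.
rewrite unitfE; apply/prodf_neq0 => i _; rewrite mxE.
by case: ifP => _; rewrite ?oner_eq0 ?gt_eqF.
Qed.

(** Since [X = X Q] for the projection [Q] to the row space, the [j]-th column
    of [X] is the image under [X] of the [j]-th column of [Q], to which the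
    coherence applies. *)
Lemma column_norm_bound (R : realType) (m n : nat) (X : 'M[R]_(m, n)) (j : 'I_n) :
  (0 < \rank X)%N ->
  dot (delta_mx 0 j *m X^T) (delta_mx 0 j *m X^T) <=
  spectral_norm X ^+ 2 * ((\rank X)%:R / n%:R * row_coherence X).
Proof.
move=> X0; have n_gt0 : (0 < n)%N := leq_trans X0 (rank_leq_col _).
have [_ normX] := spectral_norm_bound X n_gt0.
rewrite -{1 2}(mul_orthogonal_projection X) trmx_mul orthogonal_projection_sym mulmxA.
apply: (le_trans (normX _)); apply: ler_wpM2l; first exact: sqr_ge0.
exact: coherence_bound.
Qed.

(** Polarization: [4 <u, v>] is [|u + v|^2 - |u - v|^2], and the errors of the
    two squares add up to [delta] times [2 |u|^2 + 2 |v|^2]. *)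
Lemma johnson_lindenstrauss_dot (R : realType) (I J : finType) (d r : nat)
    (u : I -> 'rV[R]_d) (v : J -> 'rV[R]_d) (delta : R) :
  (0 < r)%N -> 0 < delta <= 1 ->
  4 * (#|I| * #|J|)%:R * expR (- (r%:R * delta ^+ 2 / 8)) < 1 ->
  exists G : 'M[R]_(d, r), forall i j,
    `|dot (u i *m G) (v j *m G) - dot (u i) (v j)| <=
    delta / 2 * (dot (u i) (u i) + dot (v j) (v j)).
Proof.
move=> r_gt0 delta01 small.
pose x (k : I * J * bool) : 'rV[R]_d := u k.1.1 + (-1) ^+ k.2 *: v k.1.2.
have [|G GP] := @johnson_lindenstrauss R _ d r x delta r_gt0 delta01.
  move: small; congr (_ < _); rewrite !card_prod card_bool !natrM; ring.
exists G => i j.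
have := GP (i, j, false); have := GP (i, j, true).
rewrite /x /= expr0 expr1 scale1r scaleN1r !mulmxDl mulNmx.
have expD e (a b : 'rV[R]_e) : dot (a + b) (a + b) = dot a a + dot b b + 2 * dot a b.
  by rewrite !(dotDl, dotDr) (dotC b a); ring.
have expB e (a b : 'rV[R]_e) : dot (a - b) (a - b) = dot a a + dot b b - 2 * dot a b.
  by rewrite -scaleN1r expD !(dotZl, dotZr); ring.
rewrite !expB !expD !ler_norml => /andP[l1 l2] /andP[l3 l4]; apply/andP; split; lra.
Qed.

(** The embedding is used with [delta = eps / 2].  Then [r delta^2 / 8] is at
    least [3 log N] for [N = m + n + 1], so that a failure probability of at most
    [4 m n / N^3] results. *)
Lemma low_rank_approximation (R : realType) (m n r : nat) (eps : R) (X : 'M[R]_(m, n)) :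
  (0 < \rank X)%N -> (0 < r)%N -> 0 < eps < 1 ->
  108 * ln (m + n + 1)%:R / eps ^+ 2 <= r%:R ->
  exists Y : 'M[R]_(m, n), (\rank Y <= r)%N /\
    forall i j, `|(X - Y) i j| <= eps / 4 *
      ((\rank X)%:R / m%:R * col_coherence X +
       (\rank X)%:R / n%:R * row_coherence X) * spectral_norm X.
Proof.
move=> X0 r_gt0 /andP[eps_gt0 eps_lt1] r_ge.
have sigma_gt0 := spectral_norm_gt0 X0; set sigma := spectral_norm X in sigma_gt0 *.
pose P := orthogonal_projection X^T.
have PX : P *m X = X.
  apply: trmx_inj; rewrite trmx_mul orthogonal_projection_sym.
  exact: mul_orthogonal_projection.
(* Scaling [e_i P] by [sigma] balances the two squared norms: both are then of
   the order [sigma^2], as is the product of the entry with [sigma]. *)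
pose a i : 'rV[R]_m := sigma *: (delta_mx 0 i *m P).
pose b j : 'rV[R]_m := delta_mx 0 j *m X^T.
set alpha := _ / m%:R * _; set beta := _ / n%:R * _.
have a_le i : dot (a i) (a i) <= sigma ^+ 2 * alpha.
  rewrite dotZl dotZr mulrA -expr2 ler_wpM2l ?sqr_ge0//.
  by rewrite /alpha -mxrank_tr coherence_bound// mxrank_tr.
have b_le j : dot (b j) (b j) <= sigma ^+ 2 * beta by exact: column_norm_bound.
have entry (M : 'M[R]_m) i j :
    sigma * (P *m M *m X) i j = dot (a i *m M) (b j).
  rewrite /a -scalemxAl dotZl /dot /b trmx_mul trmxK trmx_delta mulmxA -colE.
  by rewrite -!mulmxA -rowE !mxE.
set N := (m + n + 1)%:R in r_ge.
have N_gt0 : 0 < N :> R by rewrite ltr0n addn1.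
have small : 4 * (#|'I_m| * #|'I_n|)%:R * expR (- (r%:R * (eps / 2) ^+ 2 / 8)) < 1 :> R.
  have exponent : 3 * ln N <= r%:R * (eps / 2) ^+ 2 / 8.
    have lnN_ge0 : 0 <= ln N by rewrite ln_ge0// ler1n addn1.
    move: r_ge; rewrite ler_pdivrMr ?exprn_gt0//; lra.
  apply: (@le_lt_trans _ _ (4 * (m * n)%:R * expR (- (3 * ln N)))).
    by rewrite !card_ord ler_wpM2l ?mulr_ge0// ler_expR lerN2.
  rewrite -mulrN expRM_natl expRN lnK ?posrE// exprVn ltr_pdivrMr ?exprn_gt0// mul1r.
  have : 4 * (m * n)%:R < N ^+ 2 :> R.
    rewrite -natrX -(natrM _ 4) ltr_nat (leq_ltn_trans (nat_AGM2 m n))//.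
    by rewrite ltn_sqr addn1.
  move/lt_le_trans; apply; rewrite -[leLHS]mul1r [leRHS]exprS ler_wpM2r ?exprn_ge0 ?(ltW N_gt0)//.
  by rewrite /N ler1n addn1.
have [|G GP] := johnson_lindenstrauss_dot a b r_gt0 _ small.
  by apply/andP; split; lra.
exists (P *m (G *m G^T) *m X); split.
  have -> : P *m (G *m G^T) *m X = P *m G *m (G^T *m X) by rewrite !mulmxA.
  exact: leq_trans (mxrankM_maxr _ _) (rank_leq_row _).
move=> i j; rewrite -(ler_pM2l sigma_gt0).
have -> : sigma * `|(X - P *m (G *m G^T) *m X) i j| =
    `|dot (a i *m G) (b j *m G) - dot (a i) (b j)|.
  rewrite -{1}(gtr0_norm sigma_gt0) -normrM mxE mulrDr [X in _ + _ * X]mxE mulrN.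
  have -> : sigma * X i j = dot (a i) (b j) by rewrite -{1}PX -[P]mulmx1 entry mulmx1.
  by rewrite entry mulmxA dot_mulmx trmxK distrC.
apply: (le_trans (GP i j)).
have -> : sigma * (eps / 4 * (alpha + beta) * sigma) =
    eps / 2 / 2 * (sigma ^+ 2 * alpha + sigma ^+ 2 * beta) by field.
by rewrite ler_wpM2l ?lerD// !divr_ge0// ltW.
Qed.

Theorem theorem2p3 (R : realType) (m n k : nat) (k0 : R)
    (m_gt0 : (0 < m)%N) (n_gt0 : (0 < n)%N) (k_gt0 : (0 < k)%N)
    (k0E : k0 = 108 * ln (m + n + 1)%:R)
    (k_le : (k <= minn m n)%N) (k_gt : k0 < k%:R)
    (eps : R) (eps_gt : Num.sqrt (k0 / k%:R) < eps) (eps_lt1 : eps < 1)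
    (r : nat) (r_gt0 : (0 < r)%N) (r_lt : (r < k)%N)
    (r_ge : k0 / eps ^+ 2 <= r%:R)
    (X : 'M[R]_(m, n)) (rankX : \rank X = k) :
  exists Y : 'M[R]_(m, n),
    \rank Y = r /\
    mx_norm (X - Y) <=
      eps / 3 *
      (k%:R / m%:R * col_coherence X + k%:R / n%:R * row_coherence X +
       spikiness X / Num.sqrt (m%:R * n%:R)) *
      spectral_norm X.
Proof.
have X0 : (0 < \rank X)%N by rewrite rankX.
have eps_gt0 : 0 < eps by apply: le_lt_trans (sqrtr_ge0 _) eps_gt.
have eps01 : 0 < eps < 1 by rewrite eps_gt0.
rewrite k0E in r_ge.
have [Y0 [rankY0 errY0]] := low_rank_approximation X0 r_gt0 eps01 r_ge.
have sigma_gt0 := spectral_norm_gt0 X0.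
have XT0 : (0 < \rank X^T)%N by rewrite mxrank_tr.
have := coherence_gt0 XT0; have := coherence_gt0 X0.
rewrite mxrank_tr rankX -/(row_coherence X) -/(col_coherence X).
rewrite rankX in errY0; move: errY0.
set alpha := _ / m%:R * _; set beta := _ / n%:R * _; set gamma := spikiness X / _.
set sigma := spectral_norm X in sigma_gt0 *.
move=> errY0 beta_gt0 alpha_gt0.
have gamma_ge0 : 0 <= gamma.
  rewrite /gamma /spikiness !divr_ge0 ?mulr_ge0 ?sqrtr_ge0 ?(ltW sigma_gt0)//.
  exact: (normr_ge0 (X : 'M[R]_(m, n))).
set B := eps / 3 * _ * _; set B0 := eps / 4 * (alpha + beta) * sigma in errY0.
have B0_ge0 : 0 <= B0 by rewrite !mulr_ge0 ?addr_ge0 ?invr_ge0 ?ltW.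
have B0_lt : 0 < B - B0.
  have -> : B - B0 = eps * sigma * ((alpha + beta) / 12 + gamma / 3).
    by rewrite /B /B0; field.
  apply: mulr_gt0; first exact: mulr_gt0.
  by apply: ltr_wpDr; [exact: divr_ge0 | apply: divr_gt0 => //; exact: addr_gt0].
have [Y [rankY errY]] := perturb_rank rankY0 (leq_trans (ltnW r_lt) k_le) B0_lt.
exists Y; split=> //.
have -> : X - Y = (X - Y0) + - (Y - Y0) by rewrite opprB addrA subrK.
rewrite -(subrKC B0 B) (le_trans (ler_mx_norm_add _ _))// mx_normN lerD//.
by rewrite mx_normrE; apply: bigmax_le => // -[i j] _; exact: errY0.
Qed.
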